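(* For any infinite sequence of primes $\Pi=(p_1,p_2,\ldots)$ (not necessarily distinct), there exists a finitely generated infinite periodic $\Pi$-graded group.
   Context: Let $\Pi=(p_i)$ be a sequence of primes. A group $Q$ is called a $\Pi$-graded group if $Q$ admits a normal series $Q=Q_0\rhd Q_1\rhd\cdots$ (a descending chain of subgroups, each $Q_i$ normal in $Q$, consecutive terms being allowed to coincide) such that $\bigcap_i Q_i=\{1\}$ and, for each $i\ge 1$, the quotient $Q_{i-1}/Q_i$ is either trivial or abelian of exponent $p_i$. A group is periodic if every element has finite order. *)

(* Defs.v *)
From mathcomp Require Import all_boot.
From mathcomp Require Import boolp classical_sets functions cardinality.

Set Implicit Arguments.
Unset Strict Implicit.
Unset Printing Implicit Defensive.

Local Open Scope classical_set_scope.
Local Open Scope group_scope.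

Definition subgroup (G : groupType) (H : set G) : Prop := group_closed [in H].

Definition normal_subgroup (G : groupType) (H : set G) : Prop :=
  subgroup H /\ forall x y : G, H x -> H (x ^ y).

Definition finitely_generated (G : groupType) : Prop :=
  exists A : set G, finite_set A /\ smallest (@subgroup G) A = [set: G].

Definition infinite_group (G : groupType) : Prop := infinite_set [set: G].

Definition periodic (G : groupType) : Prop :=
  forall x : G, exists n : nat, (0 < n)%N /\ x ^+ n = 1.

(* The quotient H / K is represented by its set of cosets. Its operations are
   the elementwise product [setmulg] and, with neutral element K, the powers
   [coset_exp K]; it is used only for K normal and contained in H. *)
Definition setmulg (G : groupType) (X Y : set G) : set G :=
  [set z | exists x y, [/\ X x, Y y & z = x * y]].

Definition lcoset (G : groupType) (x : G) (K : set G) : set G :=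
  [set x * k | k in K].

Definition quotient (G : groupType) (H K : set G) : set (set G) :=
  [set lcoset x K | x in H].

Definition coset_exp (G : groupType) (K X : set G) (n : nat) : set G :=
  iter n (setmulg X) K.

Definition quotient_trivial (G : groupType) (H K : set G) : Prop :=
  quotient H K = [set K].

Definition quotient_abelian (G : groupType) (H K : set G) : Prop :=
  forall X Y, quotient H K X -> quotient H K Y -> setmulg X Y = setmulg Y X.

Definition quotient_exponent (G : groupType) (H K : set G) (n : nat) : Prop :=
  let annihilates m := forall X, quotient H K X -> coset_exp K X m = K in
  [/\ (0 < n)%N, annihilates n
    & forall m : nat, (0 < m)%N -> annihilates m -> (n <= m)%N].

(* Primes are indexed from 0: [p i] is the (i+1)-st prime, and it governs the
   quotient of [Q i] by [Q i.+1]. *)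
Definition graded (p : nat -> nat) (G : groupType) : Prop :=
  exists Q : nat -> set G,
    [/\ Q 0%N = [set: G],
        forall i : nat, normal_subgroup (Q i),
        forall i : nat, Q i.+1 `<=` Q i,
        \bigcap_i Q i = [set 1]
      & forall i : nat,
          quotient_trivial (Q i) (Q i.+1) \/
          (quotient_abelian (Q i) (Q i.+1) /\
           quotient_exponent (Q i) (Q i.+1) (p i))].

(* Main.v *)
(** Build finite groups T_0, T_1, ... with two marked generators, each
    T_(i+1) mapping onto T_i with non-trivial kernel, abelian of exponent p_i;
    the group sought is the group generated by the marked pairs in the product
    of the T_i.

    Each T_(i+1) lies in the wreath product of F_p (p = p_i) by T = T_i: the
    generator s acts on F_p * T by (t, x) |-> (t + v(s, x), x * s), for a
    function v on the edges of the Cayley graph of T with values in F_p.  A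
    word trivial in T stays trivial iff the sum of v along each of its walks
    vanishes, so the kernel is trivial iff v is a gradient; gradients form a
    space of dimension at most |T| inside a space of dimension 2|T|.  If g has
    order n in T, requiring g^n = 1 in T_(i+1) costs only |T|/n linear
    conditions on v, one per coset of <g>.  Impose this for the k-th word as
    soon as its order reaches 2^(k+2): at most |T|/2 conditions, so some v that
    satisfies them is not a gradient.  In the limit the k-th word either has an
    order frozen in this way or has order below 2^(k+2) in every T_i. *)

Require Import Defs.
From HB Require Import structures.
From mathcomp Require Import all_boot all_algebra all_fingroup.
From mathcomp Require Import cyclic zify.
From mathcomp Require Import boolp classical_sets functions cardinality.

Set Implicit Arguments.
Unset Strict Implicit.
Unset Printing Implicit Defensive.

Import GRing.Theory.
Local Open Scope group_scope.

(** * Positive words in two letters and their values *)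

Definition eval (M : monoidType) (a : bool -> M) (w : seq bool) : M :=
  \prod_(s <- w) a s.

Lemma eval_cons (M : monoidType) (a : bool -> M) s w :
  eval a (s :: w) = a s * eval a w.
Proof. exact: big_cons. Qed.

Lemma eval_cat (M : monoidType) (a : bool -> M) u w :
  eval a (u ++ w) = eval a u * eval a w.
Proof. exact: big_cat. Qed.

Definition wpow (w : seq bool) (n : nat) : seq bool := flatten (nseq n w).

Lemma eval_wpow (M : monoidType) (a : bool -> M) w n :
  eval a (wpow w n) = eval a w ^+ n.
Proof.
elim: n => [|n IHn]; first by rewrite /eval /wpow big_nil.
by rewrite /wpow /= eval_cat -/(wpow w n) IHn expgS.
Qed.

(** * Dimension count and a geometric bound *)

(** Rank-nullity: [ker g] has dimension at least [dim U - dim V], which exceeds [dim W] and hence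
    the dimension of the image of [f]. *)
Lemma kernel_not_sub_image (F : fieldType) (U V W : vectType F)
    (f : W -> U) (g : U -> V) : linear f -> linear g ->
  (dim W + dim V < dim U)%N ->
  exists u, g u = 0%R /\ forall x, f x <> u.
Proof.
move=> f_lin g_lin lt_dim.
pose fM := GRing.isLinear.Build _ _ _ _ f f_lin.
pose fL : {linear _ -> _} := HB.pack f fM.
pose gM := GRing.isLinear.Build _ _ _ _ g g_lin.
pose gL : {linear _ -> _} := HB.pack g gM.
have : ~~ (lker (linfun gL) <= limg (linfun fL))%VS.
  apply/negP => /dimvS le_ker_im.
  have := limg_ker_dim (linfun gL) fullv; rewrite capfv dimvf => ker_im.
  have := limg_ker_dim (linfun fL) fullv; rewrite capfv dimvf => ker_imf.
  have : (\dim (limg (linfun gL)) <= dim V)%N by rewrite -dimvf dimvS ?subvf.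
  move: lt_dim; rewrite -ker_im => lt_dim le_V.
  have le_W : (\dim (limg (linfun fL)) <= dim W)%N by rewrite -ker_imf leq_addl.
  move: lt_dim; apply/negP; rewrite -leqNgt leq_add //.
  exact: leq_trans le_ker_im le_W.
case/subvPn=> u; rewrite memv_ker lfunE => /eqP gu0 /negP u_notin.
exists u; split=> // x fx; apply: u_notin; apply/memv_imgP.
by exists x; rewrite ?memvf ?lfunE.
Qed.

Lemma sum_lt_of_geometric (m K : nat) (c : nat -> nat) :
  (0 < m)%N -> (forall k, c k * 2 ^ k.+2 <= m)%N ->
  (\sum_(k < K) c k < m)%N.
Proof.
move=> m_gt0 le_c.
(* Subtraction-free form of the partial sum bound S <= (m/2)(1 - 2^-K), which goes through by
   induction. *)
suff le_sum : ((\sum_(k < K) c k) * 2 ^ K.+1 + m <= m * 2 ^ K)%N.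
  rewrite -(ltn_pmul2r (expn_gt0 2 K.+1)) (@leq_trans (m * 2 ^ K + 1)) //.
    by rewrite addn1 ltnS (leq_trans (leq_addr m _)).
  by rewrite expnS mulnCA mul2n -addnn leq_add2l muln_gt0 m_gt0 expn_gt0.
elim: K => [|K IHK]; first by rewrite big_ord0 muln1.
rewrite big_ord_recr /=; have := le_c K; rewrite !expnS in IHK *.
move: IHK; set S := (\sum_(k < K) c k)%N; set E := (2 ^ K)%N; lia.
Qed.

(** * Sums along walks in a Cayley graph *)

(** The pair [(s, x)] stands for the edge from [x] to [x * a s]; the walk starts at [x] and spells
    [w]. *)
Fixpoint walk_sum (T : groupType) (V : zmodType) (a : bool -> T)
    (v : bool * T -> V) (w : seq bool) (x : T) : V :=
  if w is s :: w' then (v (s, x) + walk_sum a v w' (x * a s)%g)%R else 0%R.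

Section WalkSum.
Variables (T : groupType) (V : zmodType) (a : bool -> T) (v : bool * T -> V).
Implicit Types (w : seq bool) (x : T).

Lemma walk_sum_cat u w x :
  walk_sum a v (u ++ w) x = (walk_sum a v u x + walk_sum a v w (x * eval a u)%g)%R.
Proof.
elim: u x => [|s u IHu] x /=; first by rewrite /eval big_nil mulg1 add0r.
by rewrite IHu addrA eval_cons mulgA.
Qed.

Lemma walk_sum_wpow w n x :
  walk_sum a v (wpow w n) x = (\sum_(i < n) walk_sum a v w (x * eval a w ^+ i)%g)%R.
Proof.
elim: n x => [|n IHn] x; first by rewrite big_ord0.
rewrite /wpow /= walk_sum_cat -/(wpow w n) IHn big_ord_recl expg0 mulg1.
by congr (_ + _)%R; apply: eq_bigr => i _; rewrite expgS mulgA.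
Qed.

Lemma walk_sum_closed_wpow w n x :
  eval a w = 1 -> walk_sum a v (wpow w n) x = (walk_sum a v w x *+ n)%R.
Proof.
move=> w1; rewrite walk_sum_wpow w1.
under eq_bigr do rewrite expg1n mulg1.
by rewrite sumr_const card_ord.
Qed.

End WalkSum.

Lemma walk_sum_linear (T : finGroupType) (F : fieldType) (a : bool -> T) w x :
  forall (c : F) (u v : {ffun bool * T -> F^o}),
  walk_sum a (c *: u + v)%R w x = (c *: walk_sum a u w x + walk_sum a v w x)%R.
Proof.
move=> c u v; elim: w x => [|s w IHw] x /=; first by rewrite scaler0 addr0.
by rewrite IHw !ffunE scalerDr !addrA; congr (_ + _)%R; rewrite addrAC.
Qed.

(** * The wreath product extension as a permutation group *)

Section Skew.
Variables (T : finGroupType) (V : finZmodType) (a : bool -> T).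
Variable v : bool * T -> V.

Lemma skew_inj s : injective (fun z : V * T => ((z.1 + v (s, z.2))%R, z.2 * a s)).
Proof. by move=> [t x] [t' x'] /= [+ /mulIg x_eq]; rewrite -x_eq => /addIr->. Qed.

Definition skew (s : bool) : {perm V * T} := perm (@skew_inj s).

Lemma eval_skew w t x :
  eval skew w (t, x) = ((t + walk_sum a v w x)%R, x * eval a w).
Proof.
elim: w t x => [|s w IHw] t x /=.
  by rewrite /eval !big_nil perm1 addr0 mulg1.
by rewrite !eval_cons permM permE /= IHw addrA mulgA.
Qed.

(** A permutation is trivial iff it fixes every point. The displacement of [(t, x)] does not depend
    on [t], so the points [(0, x)] decide. *)
Lemma eval_skew_eq1 w :
  eval skew w = 1 <-> eval a w = 1 /\ forall x, walk_sum a v w x = 0%R.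
Proof.
split=> [w1|[w1 v0]].
  have wE x : ((0 + walk_sum a v w x)%R, x * eval a w) = (0%R, x).
    by rewrite -eval_skew w1 perm1.
  split=> [|x]; first by case: (wE 1) => _; rewrite mul1g.
  by case: (wE x); rewrite add0r.
by apply/permP=> -[t x]; rewrite eval_skew w1 v0 addr0 mulg1 perm1.
Qed.

End Skew.

(** * Gradients and closed walks *)

Section Potential.
Variables (T : finGroupType) (F : fieldType) (a : bool -> T).
Implicit Types (f : {ffun T -> F^o}).

Definition gradient f : {ffun bool * T -> F^o} :=
  [ffun z => (f (z.2 * a z.1)%g - f z.2)%R].

Lemma gradient_linear : linear gradient.
Proof.
move=> c f g; apply/ffunP=> z; rewrite !ffunE scalerBr.
by rewrite opprD addrACA.
Qed.

(** By finiteness, the generated subgroup consists of products of generators without inverses. *)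
Lemma eval_onto_gen x : x \in <<[set a true; a false]>> -> exists w, eval a w = x.
Proof.
case/gen_prodgP=> n [c c_in ->]; elim: n c c_in => [|n IHn] c c_in.
  by exists [::]; rewrite big_ord0 /eval big_nil.
have [w w_eq] := IHn (fun i => c (lift ord0 i)) (fun i => c_in (lift ord0 i)).
rewrite big_ord_recl -w_eq.
by have /set2P[->|->] := c_in ord0; [exists (true :: w)|exists (false :: w)];
  rewrite eval_cons.
Qed.

Lemma gen_mem s : a s \in <<[set a true; a false]>>.
Proof. by apply: mem_gen; case: s; rewrite !inE eqxx ?orbT. Qed.

(* A potential is obtained by summing [v] along a walk from a base point of
   each connected component (left coset of the generated subgroup). *)
Lemma closed_walk_sum_gradient (v : {ffun bool * T -> F^o}) :
  (forall w x, eval a w = 1 -> walk_sum a v w x = 0%R) ->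
  exists f, gradient f = v.
Proof.
move=> v_closed; pose G : {group T} := <<[set a true; a false]>>%G.
pose base (y : T) := repr (y *: G).
have walk_to (y : T) : exists w, base y * eval a w == y.
  have [w w_eq] : exists w, eval a w = (base y)^-1 * y.
    apply: eval_onto_gen; rewrite -/G.
    have /lcosetP[g Gg] := mem_repr y (lcoset_refl G y).
    by rewrite /base => ->; rewrite invMg mulgKV groupV.
  by exists w; rewrite w_eq mulKVg.
pose walk y := xchoose (walk_to y).
have walkP y : base y * eval a (walk y) = y := eqP (xchooseP (walk_to y)).
exists [ffun y => walk_sum a v (walk y) (base y)].
apply/ffunP=> -[s y]; rewrite !ffunE /=.
have base_eq : base (y * a s) = base y.
  by rewrite /base lcosetM lcoset_id // gen_mem.
set w1 := walk (y * a s); set w2 := rcons (walk y) s.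
have ev_w : eval a w1 = eval a w2.
  apply: (mulgI (base y)); rewrite -{1}base_eq walkP /w2 -cats1 eval_cat mulgA walkP.
  by rewrite /eval big_seq1.
(* [w'] spells the inverse of [eval a w1]. Appending it closes both walks, so their sums agree
   before the common tail. *)
pose w' := wpow w1 (#[eval a w1]).-1.
have back w : eval a w = eval a w1 -> eval a (w ++ w') = 1.
  by move=> w_eq; rewrite eval_cat w_eq eval_wpow -expgS prednK ?expg_order.
have : walk_sum a v w1 (base y) = walk_sum a v w2 (base y).
  have := v_closed _ (base y) (back w1 (erefl _)).
  rewrite -(v_closed _ (base y) (back w2 (esym ev_w))) !walk_sum_cat -ev_w.
  exact: addIr.
rewrite base_eq => ->; rewrite /w2 -cats1 walk_sum_cat walkP /= addr0.
by rewrite addrC addKr.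
Qed.

End Potential.

(** * One extension step *)

Lemma dim_ffun_regular (I : finType) (F : fieldType) : dim {ffun I -> F^o} = #|I|.
Proof. exact: muln1. Qed.

(** An enumeration of all words. An index that codes no word gives the empty word, whose order 1
    never reaches the threshold [2 ^ k.+2]. *)
Definition word (k : nat) : seq bool := odflt [::] (unpickle k).

Lemma word_pickle w : word (pickle w) = w.
Proof. by rewrite /word pickleK. Qed.

(* Translating the starting point by [eval a w] permutes cyclically the [n]
   summands, since [eval a w] has order [n]. *)
Lemma power_walk_sum_coset (T : finGroupType) (V : zmodType) (a : bool -> T)
    (v : bool * T -> V) w (n := #[eval a w]) x y :
  x \in y *: <[eval a w]> ->
  walk_sum a v (wpow w n) x = walk_sum a v (wpow w n) y.
Proof.
case/lcosetP=> _ /cycleP[i ->] ->; elim: i => [|i IHi]; first by rewrite mulg1.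
rewrite -{}IHi !walk_sum_wpow expgSr mulgA; set z := y * _.
have n_gt0 : (0 < n)%N by apply: order_gt0.
rewrite -(prednK n_gt0) big_ord_recr big_ord_recl /= addrC.
congr (_ + _)%R.
  by rewrite -mulgA -expgS prednK // expg_order !mulg1.
by apply: eq_bigr => j _; rewrite /bump /= add1n expgS mulgA.
Qed.

(* The last clause freezes the order of the [k]-th word once it is at least
   [2 ^ k.+2]. *)
Definition extension (p : nat) (T T' : finGroupType) (a : bool -> T)
    (a' : bool -> T') : Prop :=
  [/\ forall w, eval a' w = 1 -> eval a w = 1,
      forall u w, eval a u = 1 -> eval a w = 1 -> commute (eval a' u) (eval a' w),
      forall w, eval a w = 1 -> eval a' w ^+ p = 1,
      exists w, eval a w = 1 /\ eval a' w <> 1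
    & forall k, (2 ^ k.+2 <= #[eval a (word k)])%N ->
        eval a' (word k) ^+ #[eval a (word k)] = 1].

Lemma exists_extension (p : nat) (T : finGroupType) (a : bool -> T) :
  prime p -> exists (T' : finGroupType) (a' : bool -> T'), extension p a a'.
Proof.
move=> p_prime; pose F : finFieldType := 'F_p.
pose g k := eval a (word k); pose rel k := wpow (word k) #[g k].
(* The linear conditions: one per frozen word and coset of its cyclic group. Indices below |T|
   suffice, since [2 ^ k.+2] is at most an order in [T]. *)
pose long (j : 'I_#|T| * {set T}) :=
  (2 ^ j.1.+2 <= #[g j.1])%N && (j.2 \in lcosets <[g j.1]> [set: T]).
pose J : finType := {j | long j}.
have card_J : (#|J| < #|T|)%N.
  pose c k := if (2 ^ k.+2 <= #[g k])%N then #|[set: T] : <[g k]>| else 0.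
  rewrite card_sig -sum1_card.
  rewrite (eq_bigl (fun j => predT j.1 && long j)); last by move=> j.
  rewrite -(pair_big_dep predT (fun i A => long (i, A)) (fun _ _ => 1%N)) /=.
  rewrite (eq_bigr (fun i : 'I_#|T| => c i)) => [|i _].
    apply: sum_lt_of_geometric => [|k]; first by apply/card_gt0P; exists 1.
    (* Lagrange: the index times the order is |T|, and the order is at least [2 ^ k.+2]. *)
    rewrite /c; case: ifP => // le_k; rewrite -cardsT.
    by rewrite -(Lagrange (finset.subsetT <[g k]>)) mulnC leq_pmul2r ?indexg_gt0.
  rewrite /c /long /=; case: ifP => _ /=; last by rewrite big_pred0.
  by rewrite sum1_card card_lcosets.
(* One base point per coset is enough, by [power_walk_sum_coset]. *)
pose phi (v : {ffun bool * T -> F^o}) : {ffun J -> F^o} :=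
  [ffun j : J => walk_sum a v (rel (val j).1) (repr (val j).2) : F^o].
have phi_lin : linear phi.
  by move=> c u v; apply/ffunP=> j; rewrite !ffunE walk_sum_linear.
have [|v [phi_v not_grad]] := kernel_not_sub_image (@gradient_linear T F a) phi_lin.
  by rewrite !dim_ffun_regular card_prod card_bool mul2n -addnn ltn_add2l.
have pnat0 (x : F) : (x *+ p = 0)%R.
  by rewrite -mulr_natr pchar_Fp_0 // mulr0.
have rel_sum k x : (2 ^ k.+2 <= #[g k])%N -> walk_sum a v (rel k) x = 0%R.
  move=> le_k.
  have k_lt : (k < #|T|)%N.
    apply: (@leq_trans (2 ^ k.+2)); first by rewrite ltnW // ltnW // ltn_expl.
    by apply: (leq_trans le_k); rewrite -cardsT orderE subset_leq_card ?finset.subsetT.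
  have long_k : long (Ordinal k_lt, x *: <[g k]>).
    by rewrite /long /= le_k; apply/lcosetsP; exists x.
  have := congr1 (fun f : {ffun J -> F^o} => f (Sub _ long_k)) phi_v.
  rewrite !ffunE /= => <-; apply/esym/power_walk_sum_coset.
  exact: (mem_repr x (lcoset_refl _ _)).
exists {perm F * T}, (skew a v); split.
- by move=> w /eval_skew_eq1[].
- move=> u w u1 w1; apply/permP=> -[t x].
  by rewrite !permM !eval_skew u1 w1 !mulg1 addrAC.
- move=> w w1; rewrite -eval_wpow; apply/eval_skew_eq1; split=> [|x].
    by rewrite eval_wpow w1 expg1n.
  by rewrite walk_sum_closed_wpow ?pnat0.
(* If every word trivial in [T] stayed trivial, all closed walk sums would vanish and [v] would be a
   gradient. *)
- apply: contrapT => no_kernel.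
  have [w x w1|f /not_grad //] := @closed_walk_sum_gradient T F a v.
  apply: contrapT => /eqP sum_neq0; apply: no_kernel; exists w; split=> //.
  by case/eval_skew_eq1=> _ /(_ x) /eqP; apply/negP.
- move=> k le_k; rewrite -eval_wpow; apply/eval_skew_eq1; split=> [|x].
    by rewrite eval_wpow expg_order.
  exact: rel_sum.
Qed.

(** * The tower and its uniform torsion *)

Lemma exists_tower (p : nat -> nat) : (forall i, prime (p i)) ->
  exists (T : nat -> finGroupType) (a : forall i, bool -> T i),
    (forall s, a 0%N s = 1) /\ forall i, extension (p i) (a i) (a i.+1).
Proof.
move=> p_prime; pose stage := {T : finGroupType & bool -> T}.
have /choice[next nextP] (z : nat * stage) :
    exists z' : stage, extension (p z.1) (projT2 z.2) (projT2 z').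
  have [T' [a' a'P]] := exists_extension (projT2 z.2) (p_prime z.1).
  by exists (existT _ T' a').
(* Both letters have value 1 at stage 0, so that the first term of the series will be the whole
   group. *)
pose fix tower i : stage :=
  if i is j.+1 then next (j, tower j)
  else existT (fun T : finGroupType => bool -> T) {perm bool} (fun=> 1).
exists (fun i => projT1 (tower i)), (fun i => projT2 (tower i)).
by split=> // i; exact: (nextP (i, tower i)).
Qed.

Section Tower.
Variables (p : nat -> nat) (T : nat -> finGroupType) (a : forall i, bool -> T i).
Hypothesis a_ext : forall i, extension (p i) (a i) (a i.+1).

Lemma tower_le w i j : (i <= j)%N -> eval (a j) w = 1 -> eval (a i) w = 1.
Proof.
elim: j => [|j IHj]; first by rewrite leqn0 => /eqP->.
rewrite leq_eqVlt ltnS => /predU1P[-> //|/IHj le_ij].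
by have [ker _ _ _ _] := a_ext j => /ker/le_ij.
Qed.

Lemma tower_order_stable k i j : (i <= j)%N ->
  (2 ^ k.+2 <= #[eval (a i) (word k)])%N ->
  #[eval (a j) (word k)] = #[eval (a i) (word k)].
Proof.
move=> + long; elim: j => [|j IHj]; first by rewrite leqn0 => /eqP->.
rewrite leq_eqVlt ltnS => /predU1P[-> //|/IHj ord_j].
have [ker _ _ _ rel] := a_ext j; rewrite -ord_j; apply/eqP; rewrite eqn_dvd.
rewrite !order_dvdn rel ?ord_j // eqxx /= -eval_wpow; apply/eqP/ker.
by rewrite eval_wpow expg_order.
Qed.

Lemma tower_torsion w :
  exists n, (0 < n)%N /\ forall i, eval (a i) w ^+ n = 1.
Proof.
rewrite -[w]word_pickle; set k := pickle w.
have [[i long]|short] :=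
    pselect (exists i, 2 ^ k.+2 <= #[eval (a i) (word k)])%N.
  exists #[eval (a i) (word k)]; split=> [|j]; first exact: order_gt0.
  have [le_ij|/ltnW le_ji] := leqP i j.
    by rewrite -(tower_order_stable le_ij long) expg_order.
  by rewrite -eval_wpow; apply: (tower_le le_ji); rewrite eval_wpow expg_order.
(* All orders of this word are below [2 ^ k.+2], so the factorial is a common multiple of them. *)
exists (2 ^ k.+2)`!; split=> [|i]; first exact: fact_gt0.
apply/eqP; rewrite -order_dvdn dvdn_fact // order_gt0 /=.
by rewrite leqNgt; apply/negP=> /ltnW long; apply: short; exists i.
Qed.

End Tower.

(** * The group generated by the marked pairs in the product *)

Definition dprodg (I : Type) (T : I -> groupType) : Type := forall i, T i.

Section DependentProduct.
Variables (I : Type) (T : I -> groupType).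
Local Notation P := (dprodg T).

HB.instance Definition _ := gen_eqMixin P.
HB.instance Definition _ := gen_choiceMixin P.

Let one : P := fun=> 1.
Let mul (x y : P) : P := fun i => x i * y i.
Let inv (x : P) : P := fun i => (x i)^-1.

Fact dprodg_mulA : associative mul.
Proof. by move=> x y z; apply/functional_extensionality_dep=> i; apply: mulgA. Qed.
Fact dprodg_mul1 : left_id one mul.
Proof. by move=> x; apply/functional_extensionality_dep=> i; apply: mul1g. Qed.
Fact dprodg_mulr1 : right_id one mul.
Proof. by move=> x; apply/functional_extensionality_dep=> i; apply: mulg1. Qed.
Fact dprodg_mulV : left_inverse one inv mul.
Proof. by move=> x; apply/functional_extensionality_dep=> i; apply: mulVg. Qed.
Fact dprodg_mulrV : right_inverse one inv mul.
Proof. by move=> x; apply/functional_extensionality_dep=> i; apply: mulgV. Qed.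

HB.instance Definition _ := isGroup.Build P
  dprodg_mulA dprodg_mul1 dprodg_mulr1 dprodg_mulV dprodg_mulrV.

End DependentProduct.

(* Uniform torsion makes the set of values of positive words closed under
   inverses. *)
Lemma exists_residual_group (I : Type) (T : I -> groupType)
    (a : forall i, bool -> T i) :
  (forall w, exists n, (0 < n)%N /\ forall i, eval (a i) w ^+ n = 1) ->
  exists (G : groupType) (gen : bool -> G) (pi : forall i, G -> T i),
    [/\ forall i x y, pi i (x * y) = pi i x * pi i y,
        forall x, (forall i, pi i x = 1) -> x = 1,
        forall i s, pi i (gen s) = a i s
      & forall x, exists w, x = eval gen w].
Proof.
move=> torsion; pose ev w : dprodg T := fun i => eval (a i) w.
pose S : {pred dprodg T} := [pred x | `[<exists w, x = ev w>]].
have S_closed : group_closed S.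
  split=> [|x y /asboolP[u ->] /asboolP[w ->]].
    by apply/asboolP; exists [::]; apply/functional_extensionality_dep => i;
      rewrite /ev /eval big_nil.
  have [n [n_gt0 w_n]] := torsion w; apply/asboolP; exists (u ++ wpow w n.-1).
  apply/functional_extensionality_dep=> i; rewrite /ev eval_cat eval_wpow.
  congr (_ * _); apply: (mulgI (eval (a i) w)).
  by rewrite -expgS prednK // w_n mulgV.
pose GM := SubChoice_isSubGroup.Build _ S {x | x \in S} S_closed.
pose G : groupType := HB.pack {x | x \in S} GM.
have inS w : ev w \in S by apply/asboolP; exists w.
pose gen s : G := Sub (ev [:: s]) (inS _).
have gen_val s i : val (gen s) i = a i s by rewrite SubK /ev /eval big_seq1.
exists G, gen, (fun i x => val x i); split=> //.
- by move=> x x1; apply: val_inj; apply/functional_extensionality_dep.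
- move=> x; have /asboolP[w x_eq] := valP x; exists w; apply: val_inj.
  rewrite x_eq; elim: w {x x_eq} => [|s w IHw].
    rewrite /eval big_nil; apply/functional_extensionality_dep=> i.
    by rewrite /ev /eval big_nil.
  apply/functional_extensionality_dep=> i.
  by rewrite /ev !eval_cons -/(ev w i) IHw -(gen_val s i).
Qed.

(** * Quotients by the kernel of a map to a finite group *)

Section QuotientByKernel.
Variables (G : groupType) (T : finGroupType) (f : G -> T).
Hypothesis f_mul : {morph f : x y / x * y}.
Local Notation K := [set x | f x = 1]%classic.
Local Notation fiber x := [set z | f z = f x]%classic.

Lemma morph_mul1 : f 1 = 1.
Proof. by apply: (mulgI (f 1)); rewrite -f_mul !mulg1. Qed.

Lemma morph_mulV x : f x^-1 = (f x)^-1.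
Proof. by apply: (mulgI (f x)); rewrite -f_mul !mulgV morph_mul1. Qed.

Lemma morph_mulX x n : f (x ^+ n) = f x ^+ n.
Proof.
by elim: n => [|n IHn]; rewrite ?morph_mul1 // !expgS f_mul IHn.
Qed.

Lemma ker_normal_subgroup : normal_subgroup K.
Proof.
split; first split=> [|x y]; rewrite ?inE /=; first exact: morph_mul1.
  by move=> x1 y1; rewrite f_mul morph_mulV x1 y1 invg1 mulg1.
by move=> x y /= x1; rewrite /conjg !f_mul x1 mul1g -f_mul mulVg morph_mul1.
Qed.

(** Once cosets are fibers of [f], the set-level products and powers are computed on values in
    [T]. *)
Lemma lcoset_ker x : Defs.lcoset x K = fiber x.
Proof.
apply/seteqP; split=> [_ [k k1 <-]|z zx] /=; first by rewrite f_mul k1 mulg1.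
by exists (x^-1 * z); rewrite ?mulKVg //= f_mul morph_mulV zx mulVg.
Qed.

Lemma setmulg_fiber x y : setmulg (fiber x) (fiber y) = fiber (x * y).
Proof.
apply/seteqP; split=> [_ [u [w [u_x w_y ->]]]|z z_xy] /=.
  by rewrite !f_mul u_x w_y.
exists x, (x^-1 * z); split; rewrite ?mulKVg //=.
by rewrite f_mul morph_mulV z_xy f_mul mulKg.
Qed.

Lemma coset_exp_fiber x n : coset_exp K (fiber x) n = fiber (x ^+ n).
Proof.
elim: n => [|n IHn]; first by rewrite /= morph_mul1.
by rewrite /coset_exp iterS -/(coset_exp _ _ _) IHn setmulg_fiber -expgS.
Qed.

Lemma fiber_eq_ker x : fiber x = K <-> f x = 1.
Proof.
split=> [x_K|->//]; have : fiber x x by [].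
by rewrite x_K.
Qed.

Lemma quotient_ker_abelian (H : set G) :
  (forall x y, H x -> H y -> commute (f x) (f y)) -> Defs.quotient_abelian H K.
Proof.
move=> H_comm _ _ [x Hx <-] [y Hy <-]; rewrite !lcoset_ker !setmulg_fiber.
by rewrite !f_mul H_comm.
Qed.

(** For minimality: a non-trivial value [f x] with [x] in [H] has order dividing the prime [p],
    hence equal to [p], and this order divides every annihilating [m]. *)
Lemma quotient_ker_exponent (H : set G) p : prime p ->
  (forall x, H x -> f x ^+ p = 1) -> (exists x, H x /\ f x <> 1) ->
  quotient_exponent H K p.
Proof.
move=> p_prime exp_p [x [Hx fx_neq1]]; split; first exact: prime_gt0.
  move=> _ [y Hy <-]; rewrite lcoset_ker coset_exp_fiber.
  by apply/fiber_eq_ker; rewrite morph_mulX exp_p.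
move=> m m_gt0 /(_ (fiber x)) fx_m.
have : f x ^+ m = 1.
  rewrite -morph_mulX; apply/fiber_eq_ker; rewrite -coset_exp_fiber.
  by apply: fx_m; exists x => //; rewrite lcoset_ker.
move=> /eqP; rewrite -order_dvdn => /(dvdn_leq m_gt0); apply: leq_trans.
have /eqP := exp_p x Hx; rewrite -order_dvdn; case/primeP: p_prime => _ dvd_p.
by case/dvd_p/orP=> /eqP; [move/eqP; rewrite order_eq1 => /eqP|move=> ->].
Qed.

End QuotientByKernel.

(** * Infinitude and the final assembly *)

(** Choose [x i] in [Q i] outside [Q i.+1]. For i < j, [x j] lies in [Q i.+1] and [x i] does not, so
    the choices are distinct. *)
Lemma infinite_group_descending (G : groupType) (Q : nat -> set G) :
  (forall i, Q i.+1 `<=` Q i)%classic ->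
  (forall i, exists x, Q i x /\ ~ Q i.+1 x) -> infinite_group G.
Proof.
move=> Q_anti /choice[x xP] G_fin.
have Q_le i j : (i <= j)%N -> (Q j `<=` Q i)%classic.
  elim: j => [|j IHj]; first by rewrite leqn0 => /eqP->.
  by rewrite leq_eqVlt ltnS => /predU1P[-> //|/IHj le_ij] y /Q_anti/le_ij.
have x_lt i j : (i < j)%N -> x i <> x j.
  by move=> lt_ij x_eq; case: (xP i) => _; apply; rewrite x_eq;
     apply: (Q_le _ j) => //; case: (xP j).
have x_inj : injective x.
  by move=> i j x_eq; case: (ltngtP i j) => // /x_lt[].
apply: infinite_nat.
rewrite -(eq_finite_set (inj_card_eq (f := x) (in2W x_inj))).
exact: sub_finite_set G_fin.
Qed.

Theorem theorem1p2 (p : nat -> nat) (p_prime : forall i : nat, prime (p i)) :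
  exists G : groupType,
    finitely_generated G /\ infinite_group G /\ periodic G /\ graded p G.
Proof.
have [T [a [a0 a_ext]]] := exists_tower p_prime.
have [G [gen [pi [pi_mul pi_sep pi_gen words]]]] :=
  exists_residual_group (tower_torsion a_ext).
have pi_eval i w : pi i (eval gen w) = eval (a i) w.
  elim: w => [|s w IHw]; last by rewrite !eval_cons pi_mul IHw pi_gen.
  by rewrite /eval !big_nil (morph_mul1 (pi_mul i)).
(* The series is formed by the kernels of the projections to the stages; they intersect trivially
   because the projections separate points. *)
pose Q i := [set x | pi i x = 1]%classic.
have Q_anti i : (Q i.+1 `<=` Q i)%classic.
  move=> x; have [w ->] := words x; rewrite /Q /= !pi_eval.
  by have [ker _ _ _ _] := a_ext i; apply: ker.
have Q_proper i : exists x, Q i x /\ ~ Q i.+1 x.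
  have [_ _ _ [w [w1 w_neq1]] _] := a_ext i.
  by exists (eval gen w); rewrite /Q /= !pi_eval.
exists G; split; last split; last split.
- exists [set gen true; gen false]%classic; split; first exact: finite_set2.
  apply/seteqP; split=> // x _ M [M_group M_gen]; have [w ->] := words x.
  have [M1 M_div] := M_group; move: M1; rewrite inE => M1.
  have M_mul y z : M y -> M z -> M (y * z).
    move=> My Mz; have := group_closedM M_group.
    by move=> /(_ y z); rewrite !inE; apply.
  elim: w => [|s w IHw]; first by rewrite /eval big_nil.
  rewrite eval_cons; apply: M_mul => //.
  by apply: M_gen; case: s; [left|right].
- exact: infinite_group_descending Q_anti Q_proper.
- move=> x; have [w ->] := words x; have [n [n_gt0 w_n]] := tower_torsion a_ext w.
  exists n; split=> //; apply: pi_sep => i.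
  by rewrite (morph_mulX (pi_mul i)) pi_eval w_n.
exists Q; split=> //.
- apply/seteqP; split=> // x _; have [w ->] := words x; rewrite /Q /= pi_eval.
  by rewrite /eval big1.
- by move=> i; apply: ker_normal_subgroup (pi_mul i).
- apply/seteqP; split=> [x x1|_ -> i _]; last exact: morph_mul1 (pi_mul i).
  by apply: pi_sep => i; apply: x1.
(* No quotient is trivial, as each extension has a non-trivial kernel. Elements of [Q i] are words
   trivial at stage i, so their values at stage i+1 commute and have p-th power 1 for p = [p i]. *)
move=> i; right; have [_ comm exp_p _ _] := a_ext i; split.
  apply: (quotient_ker_abelian (pi_mul i.+1)) => x y; have [u ->] := words x.
  by have [w ->] := words y; rewrite /Q /= !pi_eval; apply: comm.
apply: (quotient_ker_exponent (pi_mul i.+1)) => // x; have [w ->] := words x.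
by rewrite /Q /= !pi_eval; apply: exp_p.
Qed.
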